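(* Assume $N_1\ge N_2\ge N_3$ and $T\ge \frac12\left(\sqrt{N_1^2-4N_3(N_2-N_3)}+N_1+2N_2-2\right)$. Then for every rational $R_1\in[0,C(T-N_3,N_1)]$ the rate pair $(R_1,R_2)$ with $$R_2=\min\Big(C(T-N_3,N_2),\;C(T-N_2,N_3)-C(T-N_3,N_1),\;R_2'\Big),\qquad R_2'=\frac{N_2}{N_1}\left[\frac{N_1}{N_2}-1-R_1+\frac{T+1-N_1-N_3}{T+1-N_2}\right],$$ is achievable, where $C(T,N)=\frac{T+1-N}{T+1}$.
   Context: Network: two sources, one relay, one destination; no direct source–destination link. Source $i\in\{1,2\}$ has messages $s_{t,i}\in\mathbb{F}^{k_i}$, $t\ge0$, over a finite field $\mathbb{F}$. A time-invariant $(n_1,n_2,n_3,k_1,k_2,T)_{\mathbb{F}}$ streaming code (unbounded memory): source $i$ sends at time $t$ a packet $x^{(1)}_{t,i}\in\mathbb{F}^{n_i}$, a fixed function of $s_{0,i},\dots,s_{t,i}$; a relay function $g$, the same at every time $t$, takes the packets received from both sources at times $t-T,\dots,t$ together with the relay's previously produced estimates of past source messages, and outputs a packet $x^{(2)}_t\in\mathbb{F}^{n_3}$ and estimates of $s_{t-T,1},s_{t-T,2}$; the destination outputs at time $t+T$ estimates $\hat s_{t,i}$ from its received packets up to time $t+T$. Each link is a packet erasure channel (received packet is the sent one or the erasure symbol $*$). An $N$-erasure sequence has exactly $N$ erased times; link source $i\to$relay suffers an arbitrary $N_i$-erasure sequence, relay$\to$destination an arbitrary $N_3$-erasure sequence.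 The code is $(N_1,N_2,N_3)$-achievable if $\hat s_{t,i}=s_{t,i}$ always. Rate pair: $R_i=k_i/n$, $n=\max(n_1,n_2,n_3)$; a rate pair is achievable if it is the rate pair of some $(N_1,N_2,N_3)$-achievable code (over some finite field). *)

(* Defs.v *)
From HB Require Import structures.
From mathcomp Require Import all_boot all_order all_algebra all_field.
Set Implicit Arguments. Unset Strict Implicit. Unset Printing Implicit Defensive.
Import Order.TTheory GRing.Theory Num.Theory.
Local Open Scope ring_scope.

(* A time-invariant (n1,n2,n3,k1,k2,T)_F streaming code for the two-source,
   one-relay, one-destination network.  Erasures are [None]. *)
Record code (F : finFieldType) (n1 n2 n3 k1 k2 T : nat) := Code {
  enc1 : forall t : nat, ('I_t.+1 -> 'rV[F]_k1) -> 'rV[F]_n1;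
  enc2 : forall t : nat, ('I_t.+1 -> 'rV[F]_k2) -> 'rV[F]_n2;
  (* relay function g, the same at every time t: inputs are the received
     packets from source 1 and 2 at times t-T, ..., t (entry j = time t-T+j),
     and the relay's previous estimates of past messages (entry j = estimate of
     s_{t-T-1-j}); outputs the relay packet and estimates of s_{t-T,1}, s_{t-T,2} *)
  relay : ('I_T.+1 -> option 'rV[F]_n1) -> ('I_T.+1 -> option 'rV[F]_n2) ->
          (nat -> 'rV[F]_k1) -> (nat -> 'rV[F]_k2) ->
          'rV[F]_n3 * 'rV[F]_k1 * 'rV[F]_k2;
  dec : forall t : nat, ('I_(t + T).+1 -> option 'rV[F]_n3) -> 'rV[F]_k1 * 'rV[F]_k2
}.

Definition erasure_seq (N : nat) (e : nat -> bool) : Prop :=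
  exists l : seq nat, [/\ uniq l, size l = N & forall t, e t = (t \in l)].

Section Semantics.
Variables (F : finFieldType) (n1 n2 n3 k1 k2 T : nat).
Variable (C : code F n1 n2 n3 k1 k2 T).
Variables (s1 : nat -> 'rV[F]_k1) (s2 : nat -> 'rV[F]_k2).
Variables (e1 e2 e3 : nat -> bool).

Definition x1 (t : nat) : 'rV[F]_n1 := enc1 C (fun j : 'I_t.+1 => s1 j).
Definition x2 (t : nat) : 'rV[F]_n2 := enc2 C (fun j : 'I_t.+1 => s2 j).
Definition y1 (t : nat) : option 'rV[F]_n1 := if e1 t then None else Some (x1 t).
Definition y2 (t : nat) : option 'rV[F]_n2 := if e2 t then None else Some (x2 t).

(* received packets at times t-T..t (negative times: nothing received) *)
Definition window1 (t : nat) : 'I_T.+1 -> option 'rV[F]_n1 :=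
  fun j => if (T <= t + j)%N then y1 (t + j - T) else None.
Definition window2 (t : nat) : 'I_T.+1 -> option 'rV[F]_n2 :=
  fun j => if (T <= t + j)%N then y2 (t + j - T) else None.

Definition rout := ('rV[F]_n3 * 'rV[F]_k1 * 'rV[F]_k2)%type.
Definition rdef : rout := (0, 0, 0).

(* L = relay outputs at times 0..t-1; entry j = estimate of s_{t-T-1-j}
   (produced at time t-1-j), 0 for negative message times *)
Definition hist1 (L : seq rout) (t : nat) : nat -> 'rV[F]_k1 :=
  fun j => if (T + j < t)%N then (nth rdef L (t - j.+1)).1.2 else 0.
Definition hist2 (L : seq rout) (t : nat) : nat -> 'rV[F]_k2 :=
  fun j => if (T + j < t)%N then (nth rdef L (t - j.+1)).2 else 0.

Fixpoint relay_outs (t : nat) : seq rout :=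
  match t with
  | 0 => [::]
  | t'.+1 => let L := relay_outs t' in
      rcons L (relay C (window1 t') (window2 t') (hist1 L t') (hist2 L t'))
  end.

Definition x3 (t : nat) : 'rV[F]_n3 := (nth rdef (relay_outs t.+1) t).1.1.
Definition y3 (t : nat) : option 'rV[F]_n3 := if e3 t then None else Some (x3 t).

Definition dest_est (t : nat) : 'rV[F]_k1 * 'rV[F]_k2 :=
  dec C (fun j : 'I_(t + T).+1 => y3 j).
End Semantics.

Definition achievable_code (N1 N2 N3 : nat) (F : finFieldType)
  (n1 n2 n3 k1 k2 T : nat) (C : code F n1 n2 n3 k1 k2 T) : Prop :=
  forall (s1 : nat -> 'rV[F]_k1) (s2 : nat -> 'rV[F]_k2) (e1 e2 e3 : nat -> bool),
    erasure_seq N1 e1 -> erasure_seq N2 e2 -> erasure_seq N3 e3 ->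
    forall t, dest_est C s1 s2 e1 e2 e3 t = (s1 t, s2 t).

Definition achievable_rate (N1 N2 N3 T : nat) (R1 R2 : rat) : Prop :=
  exists (F : finFieldType) (n1 n2 n3 k1 k2 : nat) (C : code F n1 n2 n3 k1 k2 T),
    [/\ achievable_code N1 N2 N3 C,
        R1 = k1%:R / (maxn n1 (maxn n2 n3))%:R
      & R2 = k2%:R / (maxn n1 (maxn n2 n3))%:R].

Definition cap (a b : rat) : rat := (a + 1 - b) / (a + 1).

(* Main.v *)
(** Source [i] splits its messages into symbols and protects them along
    diagonals with a systematic MDS code having [Ni] parities, so that the symbol
    in slot [j] is known to the relay after a delay [T - N3 - j].  The relay sends
    the symbol in slot [j] at exactly that moment, and follows the message by
    [N3] parities of an MDS code over all its slots; the whole message is then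
    recovered by the destination after a delay [T].  If at most [a], [b] and [c]
    symbols of source 1, of source 2 and of both share a slot, the packets have
    lengths [k1 + N1 a], [k2 + N2 b] and [k1 + k2 + N3 c].  Source 1 can use
    [T + 1 - N1 - N3] slots and source 2 in addition [N1 - N2] others, so the
    theorem becomes a linear program: distribute the symbols over the slots
    with all three lengths at most [n]. *)

Require Import Defs.
From HB Require Import structures.
From Stdlib Require Import ClassicalEpsilon.
From mathcomp Require Import all_boot all_order all_algebra all_field.
From mathcomp Require Import zify ring lra.
Set Implicit Arguments. Unset Strict Implicit. Unset Printing Implicit Defensive.
Import Order.TTheory GRing.Theory Num.Theory.
Local Open Scope ring_scope.

(** * Systematic MDS codes *)

(** Decodability is phrased as uniqueness because the decoders below choose any compatible input.
    The list [l] holds the erased positions: information symbols come first, parities follow from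
    position [k]. *)
Definition mds (F : finFieldType) (k N : nat) (par : 'rV[F]_k -> 'rV[F]_N) :=
  forall (u v : 'rV[F]_k) (l : seq nat), (size l <= N)%N ->
    (forall i : 'I_k, (i : nat) \notin l -> u 0 i = v 0 i) ->
    (forall r : 'I_N, (k + r)%N \notin l -> par u 0 r = par v 0 r) -> u = v.

(** Reed-Solomon: a polynomial of degree below [k] is determined by any [k] of its values at [k + N]
    distinct points. *)
Lemma mds_exists (F : finFieldType) (k N : nat) :
  (k + N <= #|F|)%N -> exists par : 'rV[F]_k -> 'rV[F]_N, mds par.
Proof.
move=> leF; pose al := nth 0 (enum F).
have al_inj (s : seq nat) : uniq s -> all (fun i => i < k + N)%N s ->
    uniq (map al s).
  move=> us /allP ss; rewrite map_inj_in_uniq // => i j /ss hi /ss hj /eqP.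
  rewrite nth_uniq -?cardE ?enum_uniq //; last 2 first.
  - exact: leq_trans hi leF.
  - exact: leq_trans hj leF.
  by move/eqP.
have key (v w : 'rV[F]_k) (s : seq nat) : uniq s ->
    all (fun i => i < k + N)%N s -> (k <= size s)%N ->
    {in s, forall i, (rVpoly v).[al i] = (rVpoly w).[al i]} -> v = w.
  move=> us ss ks e; have: rVpoly v - rVpoly w = 0.
    apply/eqP; apply/contraT => nz.
    have sz : (size (rVpoly v - rVpoly w)%R <= k)%N.
      rewrite (leq_trans (size_polyD _ _)) // size_polyN.
      by rewrite geq_max !size_poly.
    have : all (root (rVpoly v - rVpoly w)) (map al s).
      by apply/allP => _ /mapP [i si ->]; rewrite /root !hornerE e ?subrr.
    move/(max_poly_roots nz)/(_ (al_inj s us ss)); rewrite size_map.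
    by move=> /leq_trans/(_ sz); rewrite ltnNge ks.
  by move/subr0_eq/(congr1 (poly_rV (d := k))); rewrite !rVpolyK.
(* Evaluation at the first [k] points is injective on a finite set, hence bijective; encoding
   through its inverse [g] makes the code systematic. *)
pose ev (v : 'rV[F]_k) : 'rV[F]_k := \row_i (rVpoly v).[al i].
have ev_inj : injective ev.
  move=> v w /rowP e; apply: (key _ _ (iota 0 k)); rewrite ?iota_uniq ?size_iota //.
    by apply/allP => i; rewrite mem_iota /= add0n => /leq_trans -> //; rewrite leq_addr.
  by move=> i; rewrite mem_iota add0n => /= ik; have := e (Ordinal ik); rewrite !mxE.
have [g evK gK] := injF_bij ev_inj.
exists (fun u => \row_r (rVpoly (g u)).[al (k + r)%N]) => u v l sl eqi eqr.
rewrite -(gK u) -(gK v); congr ev.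
apply: (key _ _ [seq i <- iota 0 (k + N) | i \notin l]).
- by rewrite filter_uniq ?iota_uniq.
- by apply/allP => i; rewrite mem_filter mem_iota /= add0n => /andP [].
- rewrite size_filter; have := count_predC (mem l) (iota 0 (k + N)).
  rewrite size_iota.
  have : (count (mem l) (iota 0 (k + N)) <= N)%N.
    apply: leq_trans sl; rewrite -size_filter; apply: uniq_leq_size.
      by rewrite filter_uniq ?iota_uniq.
    by move=> i; rewrite mem_filter => /andP [].
  rewrite (@eq_count _ (fun i => i \notin l) (predC (mem l))) //; lia.
- move=> i; rewrite mem_filter mem_iota add0n => /andP [il /= ikN].
  have [ik|ki] := ltnP i k.
    have := eqi (Ordinal ik) il; rewrite -{1}(gK u) -{1}(gK v) !mxE; exact.
  have rN : (i - k < N)%N by lia.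
  by have := eqr (Ordinal rN); rewrite !mxE /= subnKC //; apply.
Qed.

Lemma card_inj_exists (S R : finType) :
  (#|S| <= #|R|)%N -> exists f : S -> R, injective f.
Proof.
move=> le; exists (fun x => enum_val (widen_ord le (enum_rank x))) => x y.
move/enum_val_inj/(congr1 val) => /= e; apply: enum_rank_inj; exact: val_inj.
Qed.

(** * Slots, streams and diagonal coding on the first hop *)

Section Symbol.
Variables (F : finFieldType) (k m A : nat) (pos : 'I_k -> 'I_m * 'I_A).

(** Index [c] numbers parallel codewords; a place that holds no symbol of the message is filled with
    0. *)
Definition symbol (v : 'rV[F]_k) (i : 'I_m) (c : 'I_A) : F :=
  if [pick x | pos x == (i, c)] is Some x then v 0 x else 0.

Lemma symbolE v x : injective pos -> symbol v (pos x).1 (pos x).2 = v 0 x.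
Proof.
move=> inj; rewrite /symbol -surjective_pairing.
by case: pickP => [y /eqP/inj ->//|/(_ x)]; rewrite eqxx.
Qed.
End Symbol.

(* Streams are indexed backwards: [sigma d] is the message emitted [d] time
   steps before the present one. *)
Definition backward (V : nmodType) (s : nat -> V) (t d : nat) : V :=
  if (d <= t)%N then s (t - d)%N else 0.

Lemma backwardK (V : nmodType) (s : nat -> V) t d : backward s (t + d) d = s t.
Proof. by rewrite /backward leq_addl addnK. Qed.

Section Hop.
Variables (F : finFieldType) (k m N A : nat) (pos : 'I_k -> 'I_m * 'I_A).
Variable par : 'rV[F]_m -> 'rV[F]_N.
Hypotheses (par_mds : mds par) (pos_inj : injective pos).

(* A codeword runs along a diagonal: its [i]-th information symbol belongs to
   the message emitted [i] steps after the start of the codeword. *)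
Definition diag_packet (sigma : nat -> 'rV[F]_k) (d : nat) :
    'rV[F]_k * 'M[F]_(N, A) :=
  (sigma d,
   \matrix_(r, c) par (\row_i symbol pos (sigma (d + m + r - i)%N) i c) 0 r).

Lemma eq_diag_packet sigma tau d :
  (forall e, (d <= e)%N -> sigma e = tau e) ->
  diag_packet sigma d = diag_packet tau d.
Proof.
move=> e; rewrite /diag_packet e //; congr pair; apply/matrixP => r c.
rewrite !mxE; congr (par _ _ _); apply/rowP => i; rewrite !mxE e //.
have := ltn_ord i; lia.
Qed.

Lemma diag_packet_backward s t d : (d <= t)%N ->
  diag_packet (backward s (t - d)) 0 = diag_packet (backward s t) d.
Proof.
move=> dt; have shift e : backward s (t - d) e = backward s t (d + e).
  by rewrite /backward leq_subRL // subnDA.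
rewrite /diag_packet shift addn0; congr pair; apply/matrixP => r c.
rewrite !mxE; congr (par _ _ _); apply/rowP => i; rewrite !mxE shift.
congr (symbol _ (backward _ _ _) _ _); have := ltn_ord i; lia.
Qed.

(** Slot [i0] of the message [d] steps back lies in the codeword begun [d + i0] steps back. The
    hypothesis on [d] says that all [m + N] positions of this codeword have been sent; at most [N]
    are erased, so the MDS property applies. *)
Lemma diag_packet_unique sigma tau (L : seq nat) : (size L <= N)%N ->
  (forall d, d \notin L -> diag_packet sigma d = diag_packet tau d) ->
  forall d x, (m + N <= d + (pos x).1 + 1)%N -> sigma d 0 x = tau d 0 x.
Proof.
move=> sL eqp d x; set i0 := (pos x).1; set c := (pos x).2 => le.
pose d0 := (d + i0)%N.
pose cw (rho : nat -> 'rV[F]_k) := \row_i symbol pos (rho (d0 - i)%N) i c.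
have eq_cw : cw sigma = cw tau.
  (* Position [j] of the codeword is sent [d0 - j] steps back, so [subn d0] turns erased times into
     erased positions. *)
  have back j : (j <= d0)%N -> j \notin map (subn d0) L -> (d0 - j)%N \notin L.
    move=> jd; apply: contra => /(map_f (subn d0)).
    by rewrite subKn.
  apply: (par_mds (l := map (subn d0) L)); first by rewrite size_map.
    move=> i /back nL; rewrite !mxE; congr symbol.
    have := ltn_ord i => im.
    have /eqp[->//] : (d0 - i)%N \notin L by apply: nL; rewrite /d0; lia.
  move=> r /back nL; have := ltn_ord r => rN.
  have /eqp[_ /matrixP/(_ r c)] : (d0 - (m + r))%N \notin L.
    by apply: nL; rewrite /d0; lia.
  rewrite !mxE => e; rewrite /cw.
  have cw_shift (rho : nat -> 'rV[F]_k) : \row_i symbol pos (rho (d0 - i)%N) i c =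
     \row_i symbol pos (rho (d0 - (m + r) + m + r - i)%N) i c.
    by apply/rowP => i; rewrite !mxE; congr (symbol _ (rho _) _ _); rewrite /d0; lia.
  by rewrite !cw_shift.
by have /rowP/(_ i0) := eq_cw; rewrite !mxE /d0 addnK !symbolE.
Qed.

Variables (n T : nat) (pack : 'rV[F]_k * 'M[F]_(N, A) -> 'rV[F]_n).
Hypothesis pack_inj : injective pack.

(** Compatibility of the relay's view with the stream [sigma], past estimates being exact. The time
    [t] is a parameter because the relay does not know it. *)
Definition seen (w : 'I_T.+1 -> option 'rV[F]_n) (h : nat -> 'rV[F]_k)
    (t : nat) (sigma : nat -> 'rV[F]_k) : Prop :=
  exists s e, [/\ erasure_seq N e, sigma = backward s t,
    forall j, w j = if (T <= t + j)%N then
        if e (t + j - T)%N then None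
        else Some (pack (diag_packet (backward s (t + j - T)) 0))
      else None
    & forall j, h j = backward s t (T + 1 + j)].

(* At early times the relay cannot tell negative times from erasures: the same
   window may arise at two times [t <= t'].  A position missing at time [t] is
   then either erased at time [t'] or negative, hence zero, for both. *)
Lemma seen_unique w h t t' sigma tau :
  seen w h t sigma -> seen w h t' tau ->
  forall d x, (m + N <= d + (pos x).1 + 1)%N -> sigma d 0 x = tau d 0 x.
Proof.
wlog: t t' sigma tau / (t <= t')%N => [wl|tt'].
  have [le|/ltnW le] := leqP t t'; first exact: wl.
  by move=> Hs Ht d x dx; rewrite (wl _ _ _ _ le Ht Hs).
move=> [s [e [_ -> ws hs]]] [s' [e' [[l [_ sl el]] -> ws' hs']]].
apply: (@diag_packet_unique _ _ (map (subn t') l)); first by rewrite size_map sl.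
(* A packet depends only on messages at least as old as itself, so beyond delay [T] the history
   determines it; otherwise it lies in the window. *)
move=> d dl; have [Td|dT] := ltnP T d.
  apply: eq_diag_packet => f df; have := hs (f - (T + 1))%N.
  by rewrite hs' subnKC //; lia.
have [td|dt] := ltnP t' d.
  by apply: eq_diag_packet => f df; rewrite /backward !ifF //; lia.
have jT : (T - d < T.+1)%N by lia.
have := ws (Ordinal jT); rewrite ws' /=.
have -> : (t' + (T - d) - T = t' - d)%N by lia.
rewrite ifT; last by lia.
rewrite ifF; last first.
  rewrite el; apply: contraNF dl => /(map_f (subn t')); by rewrite subKn.
case: ifP => // le; have -> : (t + (T - d) - T = t - d)%N by lia.
case: ifP => // _ [/pack_inj]; rewrite !diag_packet_backward //; lia.
Qed.
Definition source_enc (t : nat) (w : 'I_t.+1 -> 'rV[F]_k) : 'rV[F]_n :=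
  pack (diag_packet (backward (fun z => w (inord z)) t) 0).

Lemma source_encE (s : nat -> 'rV[F]_k) t :
  source_enc (fun j : 'I_t.+1 => s j) = pack (diag_packet (backward s t) 0).
Proof.
congr pack; apply: eq_diag_packet => e _; rewrite /backward.
by case: ifP => // et; rewrite inordK // ltnS leq_subr.
Qed.
End Hop.

(** * The relay code and its correctness *)

Section Construction.
Variables (F : finFieldType) (N1 N2 N3 T n k1 k2 m1 m2 A B C : nat).
Hypotheses (m1E : (m1 + N1 + N3 = T.+1)%N) (m2E : (m2 + N2 + N3 = T.+1)%N).
Hypothesis N3T : (N3 <= T)%N.
Variables (pos1 : 'I_k1 -> 'I_m1 * 'I_A) (pos2 : 'I_k2 -> 'I_m2 * 'I_B).
Variable (pos3 : 'I_(k1 + k2) -> 'I_m2 * 'I_C).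
Hypotheses (pos1_inj : injective pos1) (pos2_inj : injective pos2).
Hypothesis pos3_inj : injective pos3.
Hypothesis pos31 : forall x, (pos3 (lshift k2 x)).1 = (pos1 x).1 :> nat.
Hypothesis pos32 : forall x, (pos3 (rshift k1 x)).1 = (pos2 x).1 :> nat.
Variables (par1 : 'rV[F]_m1 -> 'rV[F]_N1) (par2 : 'rV[F]_m2 -> 'rV[F]_N2).
Variable (par3 : 'rV[F]_m2 -> 'rV[F]_N3).
Hypotheses (mds1 : mds par1) (mds2 : mds par2) (mds3 : mds par3).
Variables (pack1 : 'rV[F]_k1 * 'M[F]_(N1, A) -> 'rV[F]_n).
Variables (pack2 : 'rV[F]_k2 * 'M[F]_(N2, B) -> 'rV[F]_n).
Variables (pack3 : 'rV[F]_(k1 + k2) * 'M[F]_(N3, C) -> 'rV[F]_n).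
Hypotheses (pack1_inj : injective pack1) (pack2_inj : injective pack2).
Hypothesis pack3_inj : injective pack3.

(** Both first-hop codes have length [D + 1], so a symbol in slot [i] is known to the relay after
    delay [D - i], and a whole message after delay [D]. *)
Let D := (T - N3)%N.

(* All the symbols of one message lie in the same codewords of the second hop:
   slot [i] is sent with delay [D - i], the parities with delays [D + 1 .. T]. *)
Definition relay_packet (sigma1 : nat -> 'rV[F]_k1) (sigma2 : nat -> 'rV[F]_k2) :
    'rV[F]_(k1 + k2) * 'M[F]_(N3, C) :=
  (\row_x row_mx (sigma1 (D - (pos3 x).1)%N) (sigma2 (D - (pos3 x).1)%N) 0 x,
   \matrix_(r, c) par3 (\row_i symbol pos3
      (row_mx (sigma1 (D + 1 + r)%N) (sigma2 (D + 1 + r)%N)) i c) 0 r).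

(* Any history compatible with the received packets may be chosen: by
   [seen_unique] the symbols entering the output do not depend on it. *)
Definition relay_fun (w1 w2 : 'I_T.+1 -> option 'rV[F]_n)
    (h1 : nat -> 'rV[F]_k1) (h2 : nat -> 'rV[F]_k2) :
    'rV[F]_n * 'rV[F]_k1 * 'rV[F]_k2 :=
  let sigma := epsilon (inhabits (fun=> 0, fun=> 0)) (fun sigma =>
    exists t, seen pos1 par1 pack1 w1 h1 t sigma.1 /\
              seen pos2 par2 pack2 w2 h2 t sigma.2) in
  (pack3 (relay_packet sigma.1 sigma.2), sigma.1 T, sigma.2 T).

Definition dest_seen (t : nat) (y : 'I_(t + T).+1 -> option 'rV[F]_n)
    (v : 'rV[F]_k1 * 'rV[F]_k2) : Prop :=
  exists s1 s2 e, [/\ erasure_seq N3 e, v = (s1 t, s2 t) &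
    forall j : 'I_(t + T).+1, y j = if e j then None
      else Some (pack3 (relay_packet (backward s1 j) (backward s2 j)))].

Definition relay_code : code F n n n k1 k2 T :=
  Code (source_enc pos1 par1 pack1) (source_enc pos2 par2 pack2) relay_fun
    (fun t y => epsilon (inhabits (0, 0)) (@dest_seen t y)).

(** The output uses slot [i] only at delay [D - i] and whole messages only at delays beyond [D] or
    equal to [T]; there the chosen history agrees with the true one. *)
Lemma relay_fun_correct w1 w2 h1 h2 t sigma1 sigma2 :
  seen pos1 par1 pack1 w1 h1 t sigma1 -> seen pos2 par2 pack2 w2 h2 t sigma2 ->
  relay_fun w1 w2 h1 h2 =
    (pack3 (relay_packet sigma1 sigma2), sigma1 T, sigma2 T).
Proof.
move=> seen1 seen2; rewrite /relay_fun; set P := (P in epsilon _ P).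
have /(epsilon_spec (inhabits (fun=> 0, fun=> 0)) P) : exists sigma, P sigma.
  by exists (sigma1, sigma2), t.
case: (epsilon _ P) => tau1 tau2 [t' [/= seen1' seen2']].
have u1 := seen_unique mds1 pos1_inj pack1_inj seen1' seen1.
have u2 := seen_unique mds2 pos2_inj pack2_inj seen2' seen2.
have full1 d : (D <= d)%N -> tau1 d = sigma1 d.
  by rewrite /D => Dd; apply/rowP => x; apply: u1; lia.
have full2 d : (D <= d)%N -> tau2 d = sigma2 d.
  by rewrite /D => Dd; apply/rowP => x; apply: u2; lia.
rewrite (full1 T) ?(full2 T) ?leq_subr //; congr (pack3 (_, _), _, _).
  apply/rowP => x; rewrite !mxE; case: splitP => y xy.
    have -> : x = lshift k2 y by apply: val_inj.
    by rewrite pos31; apply: u1; have := ltn_ord (pos1 y).1; rewrite /D; lia.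
  have -> : x = rshift k1 y by apply: val_inj.
  by rewrite pos32; apply: u2; have := ltn_ord (pos2 y).1; rewrite /D; lia.
apply/matrixP => r c; rewrite !mxE full1 ?full2 //; lia.
Qed.

(** The second-hop codewords of message [t] have one position per packet and are complete by time
    [t + T], so the at most [N3] erasures that hit them can be corrected. *)
Lemma dest_seen_unique t y u v :
  @dest_seen t y u -> @dest_seen t y v -> u = v.
Proof.
move=> [s1 [s2 [e [[l [_ sl el]] -> ys]]]] [z1 [z2 [e' [_ -> yz]]]].
have pk j : (j <= t + T)%N -> j \notin l ->
    relay_packet (backward s1 j) (backward s2 j) =
    relay_packet (backward z1 j) (backward z2 j).
  move=> jt jl; have := ys (inord j); rewrite yz !inordK ?ltnS // el (negPf jl).
  by case: ifP => // _ [/pack3_inj].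
(* Position of the codeword sent at time [j]: slots go out in reverse order up to time [t + D], then
   the parities. Each erased time marks a single position. *)
pose f j := if (j <= t + D)%N then (t + D - j)%N else (m2 + (j - (t + D + 1)))%N.
suff: row_mx (s1 t) (s2 t) = row_mx (z1 t) (z2 t).
  by case/eq_row_mx => -> ->.
pose cw v c : 'rV[F]_m2 := \row_i symbol pos3 v i c.
have eq_cw c : cw (row_mx (s1 t) (s2 t)) c = cw (row_mx (z1 t) (z2 t)) c.
  apply: (mds3 (l := map f l)); first by rewrite size_map sl.
    move=> i il; have := ltn_ord i => im.
    have iD : (i <= D)%N by rewrite /D; lia.
    have /pk : (t + (D - i) <= t + T)%N by rewrite /D; lia.
    have nl : (t + (D - i))%N \notin l.
      apply: contra il => /(map_f f).
      by rewrite /f leq_add2l leq_subr addnBA // subKn // (leq_trans iD) ?leq_addl.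
    move=> /(_ nl) [/rowP eqx _]; rewrite !mxE /symbol.
    case: pickP => [x /eqP px|//]; have := eqx x.
    by rewrite mxE [RHS]mxE px !backwardK.
  move=> r rl; have := ltn_ord r => rN.
  have /pk : (t + (D + 1 + r) <= t + T)%N by rewrite /D; lia.
  have nl : (t + (D + 1 + r))%N \notin l.
    apply: contra rl => /(map_f f); rewrite /f ifF; last by lia.
    by rewrite !addnA addKn.
  by move=> /(_ nl) [_ /matrixP/(_ r c)]; rewrite mxE [RHS]mxE !backwardK.
apply/rowP => x; rewrite -!(symbolE _ x pos3_inj).
by have /rowP/(_ (pos3 x).1) := eq_cw (pos3 x).2; rewrite !mxE.
Qed.

(** By induction on time the relay's estimates are exact, so its packets are the intended ones. The
    true pair is then compatible with what the destination receives, and it is the only one. *)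
Lemma relay_code_achievable : achievable_code N1 N2 N3 relay_code.
Proof.
move=> s1 s2 e1 e2 e3 E1 E2 E3 t.
pose out tau := (pack3 (relay_packet (backward s1 tau) (backward s2 tau)),
  backward s1 tau T, backward s2 tau T).
have outs tau : relay_outs relay_code s1 s2 e1 e2 tau = mkseq out tau.
  elim: tau => // tau IH; rewrite /= IH.
  set w1 := window1 _ _ _ _; set w2 := window2 _ _ _ _.
  rewrite /mkseq -[tau.+1]addn1 iotaD map_cat cats1; congr rcons.
  apply: (relay_fun_correct (t := tau)).
    exists s1, e1; split => // [j|j].
      by rewrite /w1 /window1 /y1 /x1 /= source_encE.
    rewrite /hist1 /backward; have -> : (T + 1 + j <= tau)%N = (T + j < tau)%N by lia.
    case: ifP => // lt; rewrite nth_mkseq; last by lia.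
    rewrite /= /backward ifT; last by lia.
    by congr s1; lia.
  exists s2, e2; split => // [j|j].
    by rewrite /w2 /window2 /y2 /x2 /= source_encE.
  rewrite /hist2 /backward; have -> : (T + 1 + j <= tau)%N = (T + j < tau)%N by lia.
  case: ifP => // lt; rewrite nth_mkseq; last by lia.
  rewrite /= /backward ifT; last by lia.
  by congr s2; lia.
rewrite /dest_est /=; set y := (fun j => _).
have seen_t : dest_seen y (s1 t, s2 t).
  exists s1, s2, e3; split => // j.
  by rewrite /y /y3 /x3 outs nth_mkseq.
apply: (@dest_seen_unique t y) => //; apply: epsilon_spec; by exists (s1 t, s2 t).
Qed.
End Construction.

(** * From symbol counts per slot to a code *)

Lemma slots_exist (m A : nat) (a : 'I_m -> nat) : (forall i, a i <= A)%N ->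
  exists pos : 'I_(\sum_(i < m) a i) -> 'I_m * 'I_A,
    injective pos /\ forall x, ((pos x).2 < a (pos x).1)%N.
Proof.
move=> aA; pose S := [set p : 'I_m * 'I_A | (p.2 < a p.1)%N].
have cS : (\sum_(i < m) a i)%N = #|S|.
  rewrite -sum1_card (eq_bigl (fun p : 'I_m * 'I_A => true && (p.2 < a p.1)%N));
    last by move=> p; rewrite inE.
  rewrite -(pair_big_dep xpredT (fun i (c : 'I_A) => c < a i)%N (fun _ _ => 1%N)) /=.
  apply: eq_bigr => i _; rewrite -(big_ord_widen A (fun=> 1%N) (aA i)).
  by rewrite sum1_card card_ord.
rewrite cS; exists enum_val; split; first exact: enum_val_inj.
by move=> x; have := enum_valP x; rewrite inE.
Qed.

(** Slot [i] carries [a i] and [b i] symbols of the two sources; [A], [B], [C] are the numbers of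
    parallel codewords on the three links. *)
Lemma achievable_of_counts (N1 N2 N3 T n m1 m2 A B C : nat) (a b : nat -> nat) :
  (m1 + N1 + N3 = T.+1)%N -> (m2 + N2 + N3 = T.+1)%N ->
  (N3 <= T)%N -> (m1 <= m2)%N ->
  (forall i, i < m1 -> a i <= A)%N -> (forall i, i < m2 -> b i <= B)%N ->
  (forall i, i < m1 -> a i + b i <= C)%N ->
  (forall i, m1 <= i < m2 -> b i <= C)%N ->
  let k1 := (\sum_(i < m1) a i)%N in let k2 := (\sum_(i < m2) b i)%N in
  (k1 + N1 * A <= n)%N -> (k2 + N2 * B <= n)%N -> (k1 + k2 + N3 * C <= n)%N ->
  exists (F : finFieldType) (K : code F n n n k1 k2 T), achievable_code N1 N2 N3 K.
Proof.
move=> m1E m2E N3T m12 aA bB abC bC k1 k2 n1 n2 n3.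
(* All three codes have length at most [T + 1]. *)
have [p pT pp] := prime_above T.+1.
have cF : #|'F_p| = p by rewrite card_Fp.
have [par1 mds1] : exists par : 'rV['F_p]_m1 -> 'rV_N1, mds par.
  by apply: mds_exists; rewrite cF; lia.
have [par2 mds2] : exists par : 'rV['F_p]_m2 -> 'rV_N2, mds par.
  by apply: mds_exists; rewrite cF; lia.
have [par3 mds3] : exists par : 'rV['F_p]_m2 -> 'rV_N3, mds par.
  by apply: mds_exists; rewrite cF; lia.
have packs k N A' : (k + N * A' <= n)%N ->
    exists pack : 'rV['F_p]_k * 'M['F_p]_(N, A') -> 'rV['F_p]_n, injective pack.
  move=> le; apply: card_inj_exists.
  rewrite card_prod !card_mx !mul1n -expnD leq_exp2l //.
  by rewrite cF prime_gt1.
have [pack1 pack1I] := packs _ _ _ n1; have [pack2 pack2I] := packs _ _ _ n2.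
have [pack3 pack3I] := packs _ _ _ n3.
have [pos1 [pos1I pos1P]] := @slots_exist m1 A (fun i => a i) (fun i => aA i (ltn_ord i)).
have [pos2 [pos2I pos2P]] := @slots_exist m2 B (fun i => b i) (fun i => bB i (ltn_ord i)).
have lt1 (x : 'I_k1) : ((pos1 x).2 < C)%N.
  have := abC _ (ltn_ord (pos1 x).1); have := pos1P x; lia.
(* On the second hop the symbols of source 2 are placed after those of source 1 in a shared slot. *)
pose off (i : nat) := if (i < m1)%N then a i else 0%N.
have lt2 (x : 'I_k2) : (off (pos2 x).1 + (pos2 x).2 < C)%N.
  have := pos2P x; have := ltn_ord (pos2 x).1; rewrite /off.
  case: (ltnP (pos2 x).1 m1) => [/abC|h h']; first lia.
  have := bC (pos2 x).1; rewrite h h' => /(_ isT); lia.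
pose pos3 (x : 'I_(k1 + k2)) := match split x with
  | inl y => (widen_ord m12 (pos1 y).1, Ordinal (lt1 y))
  | inr y => ((pos2 y).1, Ordinal (lt2 y)) end.
have pos3l y : pos3 (lshift k2 y) = (widen_ord m12 (pos1 y).1, Ordinal (lt1 y)).
  by rewrite /pos3; case: split_ordP => z /eqP; rewrite ?eq_lrshift // eq_lshift => /eqP ->.
have pos3r y : pos3 (rshift k1 y) = ((pos2 y).1, Ordinal (lt2 y)).
  by rewrite /pos3; case: split_ordP => z /eqP; rewrite ?eq_rlshift // eq_rshift => /eqP ->.
have clash y z : pos3 (lshift k2 y) <> pos3 (rshift k1 z).
  rewrite pos3l pos3r => -[/(congr1 val) /= e].
  rewrite /off -e ltn_ord; have := pos1P y; lia.
have pos3I : injective pos3.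
  move=> x x'; case: (split_ordP x) => y ->; case: (split_ordP x') => z -> e.
  - congr lshift; move: e; rewrite !pos3l => -[e1 e2].
    apply: pos1I; rewrite (surjective_pairing (pos1 y)) (surjective_pairing (pos1 z)).
    congr pair; exact: val_inj.
  - by case: (clash _ _ e).
  - by case: (clash z y).
  - congr rshift; move: e; rewrite !pos3r => -[/= e1]; rewrite e1 => e2.
    apply: pos2I; rewrite (surjective_pairing (pos2 y)) (surjective_pairing (pos2 z)).
    congr pair => //; apply: val_inj => /=; lia.
exists 'F_p, (relay_code T pos1 pos2 pos3 par1 par2 par3 pack1 pack2 pack3).
apply: relay_code_achievable => // x; by rewrite ?pos3l ?pos3r.
Qed.

(** * The linear program for the slot loads *)

Lemma ge0_cases (R : realFieldType) (x : R) : 0 <= x -> x = 0 \/ 0 < x.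
Proof. by rewrite le_eqVlt => /orP[/eqP|]; auto. Qed.

(** The relay-link conditions left after eliminating the loads: all symbols spread over [m + q]
    slots; source 1 alone over [m] slots; and source 2 filling the [q] slots up to its own link's
    limit, with the rest in the [m] slots. *)
Lemma rate_bounds (R : realFieldType) (n1 n2 n3 m x q r1 r2 : R) :
  0 <= n3 -> n3 <= n2 -> n2 <= n1 -> 0 <= m -> 0 < n2 -> 0 < x ->
  x = m + n1 + n3 - n2 -> q = n1 - n2 ->
  r1 * (m + n1) <= m ->
  r2 * x * (m + n1) <= n1 * x - n3 * (m + n1) ->
  r2 * n1 * x <= n1 * x - n2 * x - n2 * r1 * x + n2 * m ->
  [/\ (r1 + r2) * x <= m + q,
      r1 * (m + n3) + m * r2 <= m &
      n2 * n3 * (r1 + r2) <= q * n3 * (1 - r2) + m * n2 * (1 - r1 - r2)].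
Proof.
move=> n30 n32 n21 m0 n2_gt0 x0 xE qE r1_le r2_le2 r2_le3.
have h : 0 < m + n1 by lra.
have q0 : 0 <= q by lra.
(* Once the positive denominators are cleared, each bound is a combination of hypotheses with
   non-negative multipliers. *)
split.
- rewrite -(ler_pM2r h).
  have : r1 * (m + n1) * x <= m * x by rewrite ler_wpM2r // ltW.
  rewrite qE; move: r2_le2; rewrite xE; lra.
- rewrite -(ler_pM2r h) -(ler_pM2r x0).
  have h1 : m * (r2 * x * (m + n1)) <= m * (n1 * x - n3 * (m + n1)).
    by rewrite ler_wpM2l.
  have h2 : r1 * (m + n1) * ((m + n3) * x) <= m * ((m + n3) * x).
    by rewrite ler_wpM2r // mulr_ge0 ?addr_ge0 // ltW.
  have h3 : 0 <= m * n3 * (n2 - n3) by rewrite !mulr_ge0 //; lra.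
  move: h1 h2; rewrite xE; lra.
(* At the maximal [r1], the sign of [e] tells which of the last two bounds on
   [r2] is the stronger one; the conclusion needs the stronger one. *)
pose e := x * n1 + (n2 - n3) ^+ 2 - x ^+ 2.
have [e0|e0] := lerP e 0.
  rewrite -(ler_pM2r h) -(ler_pM2r x0).
  have h1 : (n1 * n3 + m * n2) * (r2 * x * (m + n1)) <=
            (n1 * n3 + m * n2) * (n1 * x - n3 * (m + n1)).
    by rewrite ler_wpM2l // addr_ge0 // mulr_ge0 //; lra.
  have h2 : (n2 * n3 + m * n2) * x * (r1 * (m + n1)) <=
            (n2 * n3 + m * n2) * x * m.
    by rewrite ler_wpM2l // mulr_ge0 ?addr_ge0 ?mulr_ge0 // ltW.
  have h3 : 0 <= q * n3 * (- e) by rewrite mulr_ge0 ?mulr_ge0 ?oppr_ge0.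
  move: h1 h2 h3; rewrite /e qE xE; lra.
have n1_gt0 : 0 < n1 by lra.
rewrite -(ler_pM2r h) -(ler_pM2r x0) -(ler_pM2r n1_gt0).
have h1 : (n1 * n3 + m * n2) * (m + n1) * (r2 * n1 * x) <=
  (n1 * n3 + m * n2) * (m + n1) *
    (n1 * x - n2 * x - n2 * r1 * x + n2 * m).
  by rewrite ler_wpM2l // mulr_ge0 ?addr_ge0 ?mulr_ge0 //; lra.
have h2 : m * n2 * q * x * (r1 * (m + n1)) <= m * n2 * q * x * m.
  by rewrite ler_wpM2l // !mulr_ge0 // ltW.
have h3 : 0 <= m * n2 * q * e by rewrite !mulr_ge0 // ltW.
move: h1 h2 h3; rewrite /e qE xE; lra.
Qed.

(* In units of the packet length: each of the [m] slots usable by both sources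
   carries [al] symbols of source 1 and [b1] of source 2, each of the [q] slots
   whose delay is too short for source 1 carries [b2] symbols of source 2. *)
Definition slot_loads (R : realFieldType) (n1 n2 n3 m q r1 r2 : R) : Prop :=
  exists al b1 b2 : R, [/\ [/\ 0 <= al, 0 <= b1 & 0 <= b2],
    r1 = m * al, r2 = m * b1 + q * b2,
    [/\ r1 + n1 * al <= 1, r2 + n2 * b1 <= 1 & r2 + n2 * b2 <= 1] &
    r1 + r2 + n3 * (al + b1) <= 1 /\ r1 + r2 + n3 * b2 <= 1].

(** Source 1 spreads its symbols evenly; as [n3 <= n1], its own link is the tighter one. *)
Lemma slot_loads0 (R : realFieldType) (n1 n2 n3 m q r1 : R) :
  0 <= n1 -> n3 <= n1 -> 0 <= m -> 0 < m + n1 -> 0 <= r1 -> r1 * (m + n1) <= m ->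
  slot_loads n1 n2 n3 m q r1 0.
Proof.
move=> n10 n31 m0 h r10 r1_le; exists (r1 / m), 0, 0.
have [m_eq0|m_gt0] := ge0_cases m0.
  have -> : r1 = 0.
    by apply/le_anti/andP; split=> //; rewrite -(pmulr_lle0 _ h) -[leRHS]m_eq0.
  by rewrite mul0r; split; [split| | |split|split]; lra.
have al0 : 0 <= r1 / m by rewrite divr_ge0.
have rE : r1 = m * (r1 / m) by rewrite mulrC divfK // gt_eqF.
have le1 : r1 + n1 * (r1 / m) <= 1.
  rewrite -(ler_pM2r m_gt0) mul1r mulrDl -mulrA divfK ?gt_eqF //; lra.
have le3 : n3 * (r1 / m) <= n1 * (r1 / m) by rewrite ler_wpM2r.
have n1al : 0 <= n1 * (r1 / m) by rewrite mulr_ge0.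
move: (r1 / m) al0 rE le1 le3 n1al => al al0 rE le1 le3 n1al.
by split; [split| | |split|split] => //; lra.
Qed.

(** Source 1 is spread evenly over the shared slots. Source 2 loads its private slots as much as
    possible, [b2] being the least of [r2 / q], [(1 - r2) / n2] and [(1 - r1 - r2) / n3], which
    minimises its load on the shared ones. *)
Lemma slot_loads_pos (R : realFieldType) (n1 n2 n3 m x q r1 r2 : R) :
  0 <= n3 -> n3 <= n2 -> n2 <= n1 -> 0 <= m -> 0 < n2 -> 0 < x ->
  x = m + n1 + n3 - n2 -> q = n1 - n2 -> 0 <= r1 -> 0 <= r2 ->
  r1 * (m + n1) <= m ->
  r2 * (m + n1) <= m + q ->
  r2 * x * (m + n1) <= n1 * x - n3 * (m + n1) ->
  r2 * n1 * x <= n1 * x - n2 * x - n2 * r1 * x + n2 * m ->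
  slot_loads n1 n2 n3 m q r1 r2.
Proof.
move=> n30 n32 n21 m0 n2_gt0 x0 xE qE r10 r20 r1_le r2_le1 r2_le2 r2_le3.
have [sum_le a_le ab_le] :=
  rate_bounds n30 n32 n21 m0 n2_gt0 x0 xE qE r1_le r2_le2 r2_le3.
clear r2_le2 r2_le3; have h : 0 < m + n1 by lra.
have q0 : 0 <= q by lra.
have r2_le : r2 <= 1.
  by rewrite -(ler_pM2r h) mul1r (le_trans r2_le1) //; lra.
(* Here [x - (m + q) = n3] is non-negative. *)
have g0 : 0 <= 1 - r1 - r2.
  rewrite -(pmulr_lge0 _ x0); move: sum_le; rewrite qE xE; lra.
have sum_le' : n3 * (r1 + r2) <= (m + q) * (1 - r1 - r2).
  by move: sum_le; rewrite xE qE; lra.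
have r2_le' : n2 * r2 <= (m + q) * (1 - r2) by move: r2_le1; rewrite qE; lra.
clear x x0 xE sum_le.
have [m_eq0|m_gt0] := ge0_cases m0.
  have r1_eq0 : r1 = 0.
    by apply/le_anti/andP; split=> //; rewrite -(pmulr_lle0 _ h) -[leRHS]m_eq0.
  have [q_eq0|q_gt0] := ge0_cases q0.
    have r2_eq0 : r2 = 0.
      apply/le_anti/andP; split=> //; rewrite -(pmulr_lle0 _ h); lra.
    by rewrite r2_eq0; apply: slot_loads0 => //; lra.
  exists 0, 0, (r2 / q); have b0 : 0 <= r2 / q by rewrite divr_ge0.
  have r2E : r2 = q * (r2 / q) by rewrite mulrC divfK // gt_eqF.
  have le2 : n2 * (r2 / q) <= 1 - r2.
    by rewrite mulrA ler_pdivrMr // mulrC; move: r2_le'; rewrite m_eq0; lra.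
  have le3 : n3 * (r2 / q) <= 1 - r1 - r2.
    by rewrite mulrA ler_pdivrMr //; move: sum_le'; rewrite m_eq0 r1_eq0; lra.
  move: (r2 / q) b0 r2E le2 le3 => b b0 r2E le2 le3.
  by split; [split| | |split|split] => //; lra.
have al0 : 0 <= r1 / m by rewrite divr_ge0.
have r1E : r1 = m * (r1 / m) by rewrite mulrC divfK // gt_eqF.
have le1 : r1 + n1 * (r1 / m) <= 1.
  rewrite -(ler_pM2r m_gt0) mul1r mulrDl -mulrA divfK ?gt_eqF //; lra.
clear r1_le r2_le1 qE.
(* Given [b2], the equation for [r2] forces [b1 = (r2 - q * b2) / m]. *)
suff [b2 [b20 b2n2 b2n3 b2r2 [le_b le_ab]]] : exists b2, [/\ 0 <= b2,
    n2 * b2 <= 1 - r2, n3 * b2 <= 1 - r1 - r2, q * b2 <= r2 &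
    n2 * (r2 - q * b2) <= m * (1 - r2) /\
    n3 * (r1 + r2 - q * b2) <= m * (1 - r1 - r2)].
  exists (r1 / m), ((r2 - q * b2) / m), b2.
  have b10 : 0 <= (r2 - q * b2) / m by rewrite divr_ge0 // subr_ge0.
  have r2E : r2 = m * ((r2 - q * b2) / m) + q * b2.
    by rewrite mulrC divfK ?gt_eqF // subrK.
  have n2b1 : n2 * ((r2 - q * b2) / m) <= 1 - r2.
    by rewrite mulrA ler_pdivrMr // [leRHS]mulrC.
  have n3b1 : n3 * (r1 / m + (r2 - q * b2) / m) <= 1 - r1 - r2.
    by rewrite -mulrDl mulrA ler_pdivrMr // [leRHS]mulrC addrA.
  move: (r1 / m) (_ / m) al0 b10 r1E r2E le1 n2b1 n3b1 => al b1 al0 b10.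
  by move=> r1E r2E le1 n2b1 n3b1; split; [split| | |split|split] => //; lra.
(* Either the private slots can hold all of source 2, or one of the two link limits caps [b2]. *)
have [[fit2 fit3]|over] : (n2 * r2 <= q * (1 - r2) /\ n3 * r2 <= q * (1 - r1 - r2))
    \/ (q * (1 - r2) < n2 * r2 \/ q * (1 - r1 - r2) < n3 * r2).
  by case: (lerP (n2 * r2) (q * (1 - r2))) => ?;
     case: (lerP (n3 * r2) (q * (1 - r1 - r2))) => ?; auto.
- have [q_eq0|q_gt0] := ge0_cases q0.
    have r2_eq0 : r2 = 0.
      apply/le_anti/andP; split=> //; rewrite -(pmulr_rle0 _ n2_gt0).
      by rewrite q_eq0 mul0r in fit2.
    exists 0; rewrite !mulr0 !subr0; split=> //; [by rewrite subr_ge0|split].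
      by rewrite r2_eq0; lra.
    by move: a_le; rewrite r2_eq0; lra.
  exists (r2 / q); rewrite ![q * _]mulrC divfK ?gt_eqF //; split => //.
  + by rewrite divr_ge0.
  + by rewrite mulrA ler_pdivrMr // [leRHS]mulrC.
  + by rewrite mulrA ler_pdivrMr // [leRHS]mulrC.
  + rewrite subrr mulr0 addrK; split; last by move: a_le; lra.
    by rewrite mulr_ge0 // subr_ge0.
(* This compares the caps on [b2] from the link of source 2 and from the relay link. *)
have [le23|lt32] := lerP (n3 * (1 - r2)) (n2 * (1 - r1 - r2)).
- have b2E : n2 * ((1 - r2) / n2) = 1 - r2 by rewrite mulrC divfK // gt_eqF.
  exists ((1 - r2) / n2); split.
  + by rewrite divr_ge0 ?subr_ge0 // ltW.
  + by rewrite b2E.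
  + by rewrite mulrA ler_pdivrMr // [leRHS]mulrC.
  + rewrite mulrA ler_pdivrMr //; case: over => [/ltW|lt]; first by lra.
    have n3_gt0 : 0 < n3.
      rewrite lt_neqAle n30 andbT; apply/eqP => n3_eq0.
      by move: lt; rewrite -n3_eq0 mul0r ltNge mulr_ge0.
    rewrite -(ler_pM2l n3_gt0).
    have : q * (n3 * (1 - r2)) <= q * (n2 * (1 - r1 - r2)) by rewrite ler_wpM2l.
    have : n2 * (q * (1 - r1 - r2)) <= n2 * (n3 * r2) by rewrite ler_pM2l // ltW.
    lra.
  + split; first by rewrite mulrBr mulrCA b2E; lra.
    rewrite -(ler_pM2l n2_gt0).
    have -> : n2 * (n3 * (r1 + r2 - q * ((1 - r2) / n2))) =
      n3 * (n2 * (r1 + r2) - q * (n2 * ((1 - r2) / n2))) by ring.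
    by rewrite b2E; lra.
have n3_gt0 : 0 < n3.
  rewrite lt_neqAle n30 andbT; apply/eqP => n3_eq0.
  by move: lt32; rewrite -n3_eq0 mul0r ltNge mulr_ge0 // ltW.
have b2E : n3 * ((1 - r1 - r2) / n3) = 1 - r1 - r2 by rewrite mulrC divfK // gt_eqF.
exists ((1 - r1 - r2) / n3); split.
+ by rewrite divr_ge0.
+ by rewrite mulrA ler_pdivrMr // [leRHS]mulrC ltW.
+ by rewrite b2E.
+ rewrite mulrA ler_pdivrMr //; case: over => [lt|/ltW]; last by lra.
  rewrite -(ler_pM2l n2_gt0).
  have : q * (n2 * (1 - r1 - r2)) <= q * (n3 * (1 - r2)) by rewrite ler_wpM2l // ltW.
  have : n3 * (q * (1 - r2)) <= n3 * (n2 * r2) by rewrite ler_pM2l // ltW.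
  lra.
+ split; last by rewrite mulrBr mulrCA b2E; lra.
  rewrite -(ler_pM2l n3_gt0).
  have -> : n3 * (n2 * (r2 - q * ((1 - r1 - r2) / n3))) =
    n2 * (n3 * r2 - q * (n3 * ((1 - r1 - r2) / n3))) by ring.
  rewrite b2E.
  have : m * (n2 * (1 - r1 - r2)) <= m * (n3 * (1 - r2)) by rewrite ler_wpM2l // ltW.
  have : n2 * (n3 * (r1 + r2)) <= n2 * ((m + q) * (1 - r1 - r2)) by rewrite ler_wpM2l // ltW.
  have : 0 <= n2 * n3 * r1 by rewrite !mulr_ge0 // ltW.
  lra.
Qed.

(** * From rational loads to integer counts *)

Lemma common_denominator (u v w : rat) : 0 <= u -> 0 <= v -> 0 <= w ->
  exists n a b c : nat, [/\ (0 < n)%N, u = a%:R / n%:R, v = b%:R / n%:R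
                          & w = c%:R / n%:R].
Proof.
have frac (z : rat) : 0 <= z ->
    exists a d : nat, (0 < d)%N /\ z = a%:R / d%:R.
  move=> z0; exists `|numq z|%N, `|denq z|%N.
  rewrite absz_gt0 denq_neq0; split=> //.
  by rewrite !natr_absz !ger0_norm ?numq_ge0 ?denq_ge0 // divq_num_den.
move=> /frac[a [d [d0 ->]]] /frac[b [e [e0 ->]]] /frac[c [f [f0 ->]]].
exists (d * e * f)%N, (a * e * f)%N, (b * d * f)%N, (c * d * e)%N.
rewrite !muln_gt0 d0 e0 f0 !natrM; split=> //; field;
  by rewrite !pnatr_eq0 -!lt0n d0 e0 f0.
Qed.

Lemma sum_two_values (m1 m2 b1 b2 : nat) : (m1 <= m2)%N ->
  (\sum_(i < m2) (if i < m1 then b1 else b2) = m1 * b1 + (m2 - m1) * b2)%N.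
Proof.
move=> le; rewrite -(big_mkord xpredT (fun i => if (i < m1)%N then b1 else b2)).
rewrite (@big_cat_nat _ _ _ m1) //=; congr addn.
  rewrite (eq_big_nat _ _ (F2 := fun=> b1)) ?sum_nat_const_nat ?subn0 //.
  by move=> i /andP[_ ->].
rewrite (eq_big_nat _ _ (F2 := fun=> b2)) ?sum_nat_const_nat //.
by move=> i /andP[h _]; rewrite ltnNge h.
Qed.

(** The common denominator of the loads serves as the packet length [n], and their numerators as the
    symbol counts. *)
Lemma achievable_of_slot_loads (N1 N2 N3 T m : nat) (R1 R2 : rat) :
  (N2 <= N1)%N -> (N3 <= T)%N -> (m + N1 + N3 = T.+1)%N ->
  slot_loads N1%:R N2%:R N3%:R m%:R (N1%:R - N2%:R) R1 R2 ->
  achievable_rate N1 N2 N3 T R1 R2.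
Proof.
move=> N21 N3T mE [al [be1 [be2 [[al0 be10 be20] R1E R2E]]]].
have [n [a [b1 [b2 [n0 alE be1E be2E]]]]] := common_denominator al0 be10 be20.
have nr0 : 0 < n%:R :> rat by rewrite ltr0n.
have nz : n%:R != 0 :> rat by rewrite gt_eqF.
pose q := (N1 - N2)%N; have qE : N1%:R - N2%:R = q%:R :> rat by rewrite -natrB.
have R1E' : R1 = (m * a)%:R / n%:R by rewrite R1E alE natrM mulrA.
have R2E' : R2 = (m * b1 + q * b2)%:R / n%:R.
  by rewrite R2E qE be1E be2E natrD !natrM mulrDl !mulrA.
have toN k N c : k%:R / n%:R + N%:R * (c%:R / n%:R) <= 1 :> rat -> (k + N * c <= n)%N.
  by rewrite mulrA -mulrDl ler_pdivrMr // mul1r -natrM -natrD ler_nat.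
rewrite R1E' R2E' alE be1E be2E -!mulrDl -!natrD.
move=> [/toN le1 /toN le21 /toN le22] [/toN le31 /toN le32].
pose b i := if (i < m)%N then b1 else b2.
have mq : (m <= m + q)%N by rewrite leq_addr.
have k1E : (\sum_(i < m) a = m * a)%N by rewrite sum_nat_const card_ord.
have k2E : (\sum_(i < m + q) b i = m * b1 + q * b2)%N.
  by rewrite sum_two_values // addKn.
have [||||||||F [K achK]] := @achievable_of_counts N1 N2 N3 T n m (m + q) a
  (maxn b1 b2) (maxn (a + b1) b2) (fun=> a) b mE _ N3T mq.
- by rewrite /q; lia.
- by [].
- by move=> i _; rewrite /b; case: ifP => _ /=; lia.
- by move=> i im; rewrite /b im /=; lia.
- by move=> i /andP[h _]; rewrite /b ltnNge h /=; lia.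
- by rewrite k1E.
- by rewrite k2E; case: (leqP b1 b2).
- by rewrite k1E k2E; case: (leqP (a + b1)%N b2).
exists F, n, n, n, _, _, K; rewrite !maxnn -k1E -k2E; split=> //.
Qed.

(** * The closed formula for the rate pair *)

(** AM-GM for [N3] and [N2 - N3], whose sum is [N2]; it makes the square root in the theorem
    real. *)
Lemma discriminant_bound (N1 N2 N3 : nat) : (N2 <= N1)%N -> (N3 <= N2)%N ->
  (4 * N3 * (N2 - N3) <= N1 ^ 2)%N.
Proof.
move=> h21 h32; apply: leq_trans (_ : N2 ^ 2 <= _)%N; last by rewrite leq_exp2r.
by rewrite -[in leqRHS](subnKC h32) -mulnA (nat_AGM2 N3 (N2 - N3)).
Qed.

Lemma slot_loads_min (R : realFieldType) (n1 n2 n3 m t r1 : R) :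
  0 <= n3 -> n3 <= n2 -> n2 <= n1 -> 0 <= m -> t + 1 = m + n1 + n3 ->
  0 < t + 1 - n2 -> 0 <= r1 -> r1 <= (t - n3 + 1 - n1) / (t - n3 + 1) ->
  slot_loads n1 n2 n3 m (n1 - n2) r1
    (Num.min ((t - n3 + 1 - n2) / (t - n3 + 1))
      (Num.min ((t - n2 + 1 - n3) / (t - n2 + 1)
                - (t - n3 + 1 - n1) / (t - n3 + 1))
        (n2 / n1 * (n1 / n2 - 1 - r1 + (t + 1 - n1 - n3) / (t + 1 - n2))))).
Proof.
move=> n30 n32 n21 m0 tE x0 r10 r1_le; set r2 := Num.min _ _.
have [x xE] : exists x, x = m + n1 + n3 - n2 by exists (m + n1 + n3 - n2).
have x_gt0 : 0 < x by rewrite xE -tE.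
have h0 : 0 < m + n1 by lra.
have tE3 : t - n3 + 1 = m + n1 by lra.
have tE2 : t - n2 + 1 = x by lra.
have {}r1_le : r1 * (m + n1) <= m.
  by move: r1_le; rewrite tE3 ler_pdivlMr // addrK.
have c1E : (t - n3 + 1 - n2) / (t - n3 + 1) = (m + (n1 - n2)) / (m + n1).
  by rewrite tE3 addrA.
have c2E : (t - n2 + 1 - n3) / (t - n2 + 1) -
    (t - n3 + 1 - n1) / (t - n3 + 1) =
    (n1 * x - n3 * (m + n1)) / (x * (m + n1)).
  by rewrite tE2 tE3; field; rewrite !gt_eqF.
have c1_ge0 : 0 <= (m + (n1 - n2)) / (m + n1).
  by apply: divr_ge0; [lra|exact: ltW].
have c2_ge0 : 0 <= (n1 * x - n3 * (m + n1)) / (x * (m + n1)).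
  apply: divr_ge0; last by rewrite mulr_ge0 // ltW.
  (* The numerator is the sum of this product and the next. *)
  have h1 : 0 <= (n1 - n3) * (m + n1 - n2).
    by apply: mulr_ge0; lra.
  have h2 : 0 <= n3 * (n1 - n2) by apply: mulr_ge0; lra.
  by rewrite xE; lra.
(* For [n2 = 0] the third term is 0, because its factor [n2 / n1] vanishes, so the minimum is 0. *)
have [n2_eq0|n2_gt0] := ge0_cases (le_trans n30 n32).
  have -> : r2 = 0.
    rewrite /r2 c1E c2E [X in X / n1]n2_eq0 !mul0r.
    by rewrite (min_idPr c2_ge0) (min_idPr c1_ge0).
  by apply: slot_loads0 => //; lra.
have n1_gt0 : 0 < n1 by lra.
have c3E : n2 / n1 * (n1 / n2 - 1 - r1 + (t + 1 - n1 - n3) / (t + 1 - n2)) =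
    (n1 * x - n2 * x - n2 * r1 * x + n2 * m) / (n1 * x).
  have -> : t + 1 - n1 - n3 = m by lra.
  have -> : t + 1 - n2 = x by lra.
  by field; rewrite !gt_eqF.
have c3_ge0 : 0 <= (n1 * x - n2 * x - n2 * r1 * x + n2 * m) / (n1 * x).
  apply: divr_ge0; last by rewrite mulr_ge0 // ltW.
  have e1 : r1 * x <= r1 * (m + n1) by rewrite ler_wpM2l //; lra.
  have h1 : n2 * (r1 * x) <= n2 * m.
    by apply: ler_wpM2l; [exact: ltW|exact: le_trans r1_le].
  have h2 : 0 <= (n1 - n2) * x by rewrite mulr_ge0 ?subr_ge0 // ltW.
  by lra.
have r2_ge0 : 0 <= r2 by rewrite /r2 !le_min c1E c2E c3E c1_ge0 c2_ge0 c3_ge0.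
have : r2 <= r2 by [].
rewrite {2}/r2 !le_min c1E c2E c3E !ler_pdivlMr ?mulr_gt0 // !mulrA.
move=> /and3P[r2_le1 r2_le2 r2_le3].
exact: (slot_loads_pos (x := x)).
Qed.

Theorem theorem2 (N1 N2 N3 T : nat) :
  (N2 <= N1)%N -> (N3 <= N2)%N ->
  (sqrtC ((N1 ^ 2)%:R - (4 * N3 * (N2 - N3))%:R : algC)
     + N1%:R + 2 * N2%:R - 2) / 2 <= (T%:R : algC) ->
  forall R1 : rat,
    0 <= R1 -> R1 <= cap (T%:R - N3%:R) N1%:R ->
    achievable_rate N1 N2 N3 T R1
      (Num.min (cap (T%:R - N3%:R) N2%:R)
        (Num.min (cap (T%:R - N2%:R) N3%:R - cap (T%:R - N3%:R) N1%:R)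
          (N2%:R / N1%:R *
             (N1%:R / N2%:R - 1 - R1
              + (T%:R + 1 - N1%:R - N3%:R) / (T%:R + 1 - N2%:R))))).
Proof.
move=> N21 N32 hT R1 R10; rewrite /cap => R1cap.
(* This follows from the bound on [T] since the square root is non-negative. *)
have N2T : (N1 + 2 * N2 <= 2 * T + 2)%N.
  have s0 : 0 <= sqrtC ((N1 ^ 2)%:R - (4 * N3 * (N2 - N3))%:R : algC).
    by rewrite sqrtC_ge0 subr_ge0 ler_nat discriminant_bound.
  rewrite -(ler_nat algC) 2!natrD 2!natrM -lerBlDr.
  move: hT; rewrite ler_pdivrMr ?ltr0n // [T%:R * _]mulrC; apply: le_trans.
  by rewrite lerD2r lerD2r lerDr.
have N3T : (N3 <= T)%N by lia.
(* The interval for [R1] contains a point, so its upper end is non-negative. *)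
have mN : (N1 + N3 <= T.+1)%N.
  have h0 : 0 < T%:R - N3%:R + 1 :> rat.
    by rewrite -natrB // natr1 ltr0n.
  have := le_trans R10 R1cap; rewrite pmulr_lge0 ?invr_gt0 // subr_ge0.
  by rewrite -natrB // natr1 ler_nat; lia.
have mE : (T.+1 - (N1 + N3) + N1 + N3 = T.+1)%N by lia.
apply: (achievable_of_slot_loads N21 N3T mE).
apply: slot_loads_min; rewrite ?ler0n ?ler_nat //.
  by rewrite natr1 -!natrD mE.
by rewrite subr_gt0 natr1 ltr_nat; lia.
Qed.
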